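(* Let $\mathcal N$ be a bounded DPN with transitions $T$, labelling $\ell$, initial marking $M_I$ and final marking $M_F$, let $\mathcal B=\langle B,b_I,\mathcal A,\Delta,\{b_F\},V,\alpha_I,\mathit{guard}\rangle$ be the DDS obtained from $\mathcal N$ (so $b_I=M_I$, $b_F=M_F$, and states of $B$ are markings), and let $CG_{\mathcal B}=\langle S,s_0,\gamma\rangle$ be its constraint graph from $(b_I,C_{\alpha_I})$. Then: (1) there is a node $(b,\phi)\in S$ with $b\neq b_F$ such that $\mathit{blocked}(b,\phi)$ is satisfiable if and only if $\mathcal B$ has a blocked state; (2) there is a transition $t\in T$ such that no edge $(s,\ell(t),s')\in\gamma$ exists for any $s,s'$ if and only if $\mathcal N$ has a transition $t$ such that $(b,\ell(t),b')\in\Delta$ is unreachable in $\mathcal B$ for all $b,b'\in B$; (3) there is a node $(b,\phi)\in S$ whose state $b$ is a marking $M$ with $M\geq M_F$ if and only if some $b\in B$ which is a marking $M$ with $M\geq M_F$ is reachable in $\mathcal B$.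
   Context: DPN: $\mathcal N=\langle P,T,F,\ell,\mathcal A,V,\mathit{guard}\rangle$ with places $P$, transitions $T$, flow $F:(P\times T)\cup(T\times P)\to\mathbb N$, labelling $\ell:T\to\mathcal A$, typed variables $V$ (types bool, int, rat with domains $\mathbb B,\mathbb Z,\mathbb Q$), and $\mathit{guard}(t)$ a constraint (conjunction of boolean atoms and comparisons $\neq,=,\geq,>$ of linear integer or rational expressions) over $V^r\cup V^w$, disjoint read/written copies of $V$; initial marking $M_I$, initial assignment $\alpha_I$, final marking $M_F$; bounded means at most $k$ tokens per place in reachable markings for some $k$. Its DDS: states are markings with at most $k$ tokens per place, initial state $M_I$, final states $\{M_F\}$, $(M,a,M')\in\Delta$ iff some $t$ with $\ell(t)=a$ has $M(p)\geq F(p,t)$ and $M'(p)=M(p)-F(p,t)+F(t,p)$ for all $p$, and the guard of action $\ell(t)$ is $\mathit{guard}(t)$. DDS semantics: for a DDS $\langle B,b_I,\mathcal A,\Delta,B_F,V,\alpha_I,\mathit{guard}\rangle$ with $\mathit{write}(a)=\{v\mid v^w$ occurs in $\mathit{guard}(a)\}$, a step $(b,\alpha)\xrightarrow{a,\beta}(b',\alpha')$ holds if $(b,a,b')\in\Delta$, $\beta$ assigns $V^r\cup V^w$ with $\beta(v^r)=\alpha(v)$ for all $v$, $\beta\models\mathit{guard}(a)$, and $\alpha'(v)=\beta(v^w)$ for $v\in\mathit{write}(a)$, $\alpha'(v)=\alpha(v)$ otherwise. Derivations are finite step sequences, runs are derivations from $(b_I,\alpha_I)$. A state $b$ (transition $(b,a,b')$)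 is reachable if some run reaches $b$ (takes that transition). $\mathcal B$ has a blocked state if some run reaches $(b,\alpha)$ from which no derivation reaches a configuration with a final state. Constraint graphs: $\Delta_a=\mathit{guard}(a)\wedge\bigwedge_{v\notin\mathit{write}(a)}v^w=v^r$; $\mathit{update}(\phi,a)$ is a quantifier-free formula equivalent to $\exists\vec U.\,\phi[\vec U/\vec V]\wedge\Delta_a[\vec U/\vec V^r,\vec V/\vec V^w]$ with $\vec U$ a fresh copy of $\vec V$. $C_\alpha=\bigwedge_{v\in V}v=\alpha(v)$. A constraint graph from initial node $(b_0,\chi)$ is the least graph with nodes $(b,\phi)$ containing $(b_0,\chi)$ such that whenever $(b,\phi)$ is a node, $(b,a,b')\in\Delta$ and $\mathit{update}(\phi,a)$ is satisfiable, there is a node $(b',\phi')$ with $\phi'\equiv\mathit{update}(\phi,a)$ and an edge $(b,\phi)\xrightarrow{a}(b',\phi')$. $CG_{\mathcal B}$ has initial node $(b_I,C_{\alpha_I})$. For $b\in B$, with fresh variables $V_0=\{v_0\mid v\in V\}$, $CG_{\mathcal B}(b)$ has initial node $(b,\bigwedge_{v\in V}v=v_0)$; let $\mathit{final}(b)$ be the set of formulas $\psi$ with $(b_F,\psi)$ a node of $CG_{\mathcal B}(b)$. Then $\mathit{blocked}(b,\phi)=\phi[\vec V_0/\vec V]\wedge\neg\big(\exists\vec V.\bigvee_{\psi\in\mathit{final}(b)}\psi\big)$ (with $\phi$'s variables $V$ renamed to $V_0$); it is satisfiable iff some assignment $\alpha$ of $V_0$ satisfies $\phi[\vec V_0/\vec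 V]$ and, for every $\psi\in\mathit{final}(b)$, no extension of $\alpha$ to $V_0\cup V$ satisfies $\psi$. *)

(* Defs.v *)
From HB Require Import structures.
From mathcomp Require Import all_boot all_order all_algebra.

Set Implicit Arguments.
Unset Strict Implicit.
Unset Printing Implicit Defensive.

Import Order.TTheory GRing.Theory Num.Theory.

Inductive vtype := TBool | TInt | TRat.

Definition dom (ty : vtype) : Type :=
  match ty with TBool => bool | TInt => int | TRat => rat end.

(* A finite set of typed variables, given as its three sorts:
   [V ty] is the set of variables of type [ty]. *)
Definition vars := vtype -> finType.

Definition asg (V : vars) := forall ty, V ty -> dom ty.

Definition vnone : vars := fun _ => void : finType.

Definition vsum (X Y : vars) : vars := fun ty => (X ty + Y ty)%type : finType.

Definition noasg : asg vnone := fun ty (v : void) => match v with end.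

Definition join (X Y : vars) (r : asg X) (s : asg Y) : asg (vsum X Y) :=
  fun ty (v : (X ty + Y ty)%type) =>
    match v with inl x => r ty x | inr y => s ty y end.

(* Linear expressions over variables [X], with coefficients in [K]. *)
Inductive lin (X K : Type) :=
| LVar of X
| LConst of K
| LAdd of lin X K & lin X K
| LScale of K & lin X K.

Arguments LVar {X K}.
Arguments LConst {X K}.

Fixpoint lin_eval (X : Type) (K : nzRingType) (s : X -> K) (e : lin X K) : K :=
  match e with
  | LVar x => s x
  | LConst c => c
  | LAdd e1 e2 => (lin_eval s e1 + lin_eval s e2)%R
  | LScale c e1 => (c * lin_eval s e1)%R
  end.

Fixpoint lin_occurs (X : eqType) (K : Type) (x : X) (e : lin X K) : bool :=
  match e with
  | LVar y => x == y
  | LConst _ => false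
  | LAdd e1 e2 => lin_occurs x e1 || lin_occurs x e2
  | LScale _ e1 => lin_occurs x e1
  end.

Inductive cmp := Neq | Eq | Ge | Gt.

Definition cmp_eval (R : realDomainType) (o : cmp) (x y : R) : bool :=
  match o with
  | Neq => x != y
  | Eq => x == y
  | Ge => (x >= y)%R
  | Gt => (x > y)%R
  end.

(* [ALit true x] is the atom [x] and [ALit false x] its negation. *)
Inductive atom (V : vars) :=
| AConst of bool
| ALit of bool & V TBool
| AInt of cmp & lin (V TInt) int & lin (V TInt) int
| ARat of cmp & lin (V TRat) rat & lin (V TRat) rat.

Arguments AConst {V}.
Arguments ALit {V}.
Arguments AInt {V}.
Arguments ARat {V}.

Definition atom_sat (V : vars) (s : asg V) (c : atom V) : bool :=
  match c with
  | AConst b => b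
  | ALit b x => s TBool x == b
  | AInt o e1 e2 =>
      cmp_eval o (lin_eval (s TInt : V TInt -> int) e1)
                 (lin_eval (s TInt : V TInt -> int) e2)
  | ARat o e1 e2 =>
      cmp_eval o (lin_eval (s TRat : V TRat -> rat) e1)
                 (lin_eval (s TRat : V TRat -> rat) e2)
  end.

Definition atom_occurs (V : vars) (c : atom V) : forall ty, V ty -> bool :=
  match c with
  | AConst _ => fun _ _ => false
  | ALit _ x => fun ty =>
      match ty with TBool => fun v => v == x | _ => fun _ => false end
  | AInt _ e1 e2 => fun ty =>
      match ty with
      | TInt => fun v => lin_occurs v e1 || lin_occurs v e2
      | _ => fun _ => false
      end
  | ARat _ e1 e2 => fun ty =>
      match ty with
      | TRat => fun v => lin_occurs v e1 || lin_occurs v e2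
      | _ => fun _ => false
      end
  end.

(* A constraint is the conjunction of a list of atoms. *)
Definition constraint (V : vars) := seq (atom V).

Definition constraint_sat (V : vars) (s : asg V) (c : constraint V) : bool :=
  all (atom_sat s) c.

Definition occurs (V : vars) (c : constraint V) (ty : vtype) (v : V ty) : bool :=
  has (fun x => atom_occurs x v) c.

(* V^r \cup V^w: [inl v] is v^r and [inr v] is v^w. *)
Definition rw (V : vars) : vars := vsum V V.

Definition written (V : vars) (c : constraint (rw V)) (ty : vtype) (v : V ty) :
  bool := occurs c (inr v : rw V ty).

Definition data_step (V : vars) (c : constraint (rw V))
    (al : asg V) (be : asg (rw V)) (al' : asg V) : Prop :=
  [/\ forall ty (v : V ty), be ty (inl v) = al ty v,
      constraint_sat be c
    & forall ty (v : V ty),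
        al' ty v = if written c v then be ty (inr v) else al ty v].

(* Quantifier-free formulas. Divisibility by integer constants is included
   because linear integer arithmetic admits quantifier elimination only in a
   language with these predicates. *)
Inductive formula (V : vars) :=
| FAtom of atom V
| FDvd of int & lin (V TInt) int
| FNot of formula V
| FAnd of formula V & formula V
| FOr of formula V & formula V.

Arguments FAtom {V}.

Fixpoint sat (V : vars) (s : asg V) (f : formula V) : bool :=
  match f with
  | FAtom c => atom_sat s c
  | FDvd d e => (d %| lin_eval (s TInt : V TInt -> int) e)%Z
  | FNot f1 => ~~ sat s f1
  | FAnd f1 f2 => sat s f1 && sat s f2
  | FOr f1 f2 => sat s f1 || sat s f2
  end.

Definition fconj (V : vars) (fs : seq (formula V)) : formula V :=
  foldr (@FAnd V) (FAtom (AConst true)) fs.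

Definition fconj_vars (V W : vars) (f : forall ty, V ty -> formula W) :
  formula W :=
  fconj ([seq f TBool v | v <- enum (V TBool)]
      ++ [seq f TInt v | v <- enum (V TInt)]
      ++ [seq f TRat v | v <- enum (V TRat)]).

Definition feq_const (V : vars) (ty : vtype) : V ty -> dom ty -> formula V :=
  match ty with
  | TBool => fun v d => FAtom (ALit d v)
  | TInt => fun v d => FAtom (AInt Eq (LVar v) (LConst d))
  | TRat => fun v d => FAtom (ARat Eq (LVar v) (LConst d))
  end.

Definition feq_var (V : vars) (ty : vtype) : V ty -> V ty -> formula V :=
  match ty with
  | TBool => fun v w =>
      FOr (FAnd (FAtom (ALit true v)) (FAtom (ALit true w)))
          (FAnd (FAtom (ALit false v)) (FAtom (ALit false w)))
  | TInt => fun v w => FAtom (AInt Eq (LVar v) (LVar w))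
  | TRat => fun v w => FAtom (ARat Eq (LVar v) (LVar w))
  end.

Record dds (V : vars) (A : finType) := DDS {
  state : finType;
  init : state;
  delta : state -> A -> state -> Prop;
  final : state -> Prop;
  init_asg : asg V;
  action_guard : A -> constraint (rw V) }.

Arguments init_asg {V A} B ty v : rename.

Section DDS.
Variables (V : vars) (A : finType) (B : dds V A).

Definition config := (state B * asg V)%type.

Definition step (x : config) (a : A) (be : asg (rw V)) (y : config) : Prop :=
  delta x.1 a y.1 /\ data_step (action_guard B a) x.2 be y.2.

Inductive derivation (x : config) : config -> Prop :=
| derivation_nil : derivation x x
| derivation_step y a be z :
    derivation x y -> step y a be z -> derivation x z.

Definition run_to (x : config) : Prop := derivation (init B, init_asg B) x.

Definition reachable_state (b : state B) : Prop := exists al, run_to (b, al).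

Definition reachable_transition (b : state B) (a : A) (b' : state B) : Prop :=
  exists al be al', run_to (b, al) /\ step (b, al) a be (b', al').

Definition has_blocked_state : Prop :=
  exists x, run_to x /\ ~ exists y, derivation x y /\ final y.1.

Definition trans_formula (a : A) : formula (rw V) :=
  FAnd (fconj [seq FAtom c | c <- action_guard B a])
       (fconj_vars (fun ty (v : V ty) =>
          if written (action_guard B a) v then FAtom (AConst true)
          else feq_var (inr v : rw V ty) (inl v : rw V ty))).

Section ConstraintGraph.
(* Formulas in a constraint graph are over [vsum X V], where the variables [X]
   are not affected by updates: [X] is empty for the constraint graph of [B],
   and is the fresh copy V_0 of [V] for the graphs starting in a state. *)
Variable X : vars.

(* The truth value, at the assignment [r] of [X] and [al] of [V], of
   exists U, phi[U/V] /\ Delta_a[U/V^r, V/V^w]. *)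
Definition update (phi : formula (vsum X V)) (a : A) (r : asg X) (al : asg V) :
  Prop :=
  exists u : asg V, sat (join r u) phi /\ sat (join u al) (trans_formula a).

Definition update_satisfiable (phi : formula (vsum X V)) (a : A) : Prop :=
  exists r al, update phi a r al.

Definition equiv_update (phi' phi : formula (vsum X V)) (a : A) : Prop :=
  forall r al, sat (join r al) phi' <-> update phi a r al.

Definition cgnode := (state B * formula (vsum X V))%type.

Record cgraph := CGraph {
  node : cgnode -> Prop;
  edge : cgnode -> A -> cgnode -> Prop }.

Definition cg_closed (s0 : cgnode) (G : cgraph) : Prop :=
  [/\ node G s0,
      forall s a s', edge G s a s' -> node G s /\ node G s'
    & forall b phi a b',
        node G (b, phi) -> delta b a b' -> update_satisfiable phi a ->
        exists phi', [/\ equiv_update phi' phi a,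
                         node G (b', phi') & edge G (b, phi) a (b', phi')]].

Definition subgraph (G G' : cgraph) : Prop :=
  (forall s, node G s -> node G' s) /\
  (forall s a s', edge G s a s' -> edge G' s a s').

(* As phi' in [cg_closed] is only determined up to equivalence, "the least
   graph" means a closed graph without proper closed subgraph. *)
Definition is_constraint_graph (s0 : cgnode) (G : cgraph) : Prop :=
  cg_closed s0 G /\
  forall G', subgraph G' G -> cg_closed s0 G' -> subgraph G G'.

End ConstraintGraph.

Definition init_formula : formula (vsum vnone V) :=
  fconj_vars (fun ty (v : V ty) =>
    feq_const (inr v : vsum vnone V ty) (init_asg B ty v)).

(* In [vsum V V] below, [inl v] is v_0 and [inr v] is v. *)
Definition copy_formula : formula (vsum V V) :=
  fconj_vars (fun ty (v : V ty) =>
    feq_var (inr v : vsum V V ty) (inl v : vsum V V ty)).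

Definition is_CG (G : cgraph vnone) : Prop :=
  is_constraint_graph (init B, init_formula) G.

Definition is_CG_from (b : state B) (G : cgraph V) : Prop :=
  is_constraint_graph (b, copy_formula) G.

Definition final_formula (Gb : cgraph V) (psi : formula (vsum V V)) : Prop :=
  exists bF, final bF /\ node Gb (bF, psi).

(* Satisfiability of blocked(b, phi), where [Gb] is the constraint graph from
   [b]; [al] is the assignment of V_0. *)
Definition blocked_satisfiable (Gb : cgraph V) (phi : formula (vsum vnone V)) :
  Prop :=
  exists al : asg V,
    sat (join noasg al) phi /\
    forall psi, final_formula Gb psi ->
      ~ exists al' : asg V, sat (join al al') psi.

End DDS.

Record dpn := DPN {
  place : finType;
  trans : finType;
  act : finType;
  flow : (place * trans) + (trans * place) -> nat;
  label : trans -> act;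
  dvars : vars;
  guard : trans -> constraint (rw dvars);
  init_marking : place -> nat;
  init_data : asg dvars;
  final_marking : place -> nat }.

Arguments init_data : clear implicits.

Section DPN.
Variable N : dpn.

Definition marking := place N -> nat.

Definition fires (M : marking) (t : trans N) (M' : marking) : Prop :=
  forall p, flow (inl (p, t)) <= M p /\
            M' p = M p - flow (inl (p, t)) + flow (inr (t, p)).

Inductive dpn_reachable : marking -> asg (dvars N) -> Prop :=
| dpn_reachable_init : dpn_reachable (@init_marking N) (init_data N)
| dpn_reachable_step M al t be M' al' :
    dpn_reachable M al -> fires M t M' -> data_step (guard t) al be al' ->
    dpn_reachable M' al'.

Definition k_bounded (k : nat) : Prop :=
  forall M al, dpn_reachable M al -> forall p, M p <= k.

Lemma k_bounded_init (k : nat) (hk : k_bounded k) (p : place N) :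
  init_marking p < k.+1.
Proof. exact: hk dpn_reachable_init p. Qed.

Definition bmarking (k : nat) := {ffun place N -> 'I_k.+1}.

Definition tokens (k : nat) (M : bmarking k) : marking := fun p => M p.

Definition dds_of (k : nat) (hk : k_bounded k)
    (g : act N -> constraint (rw (dvars N))) : dds (dvars N) (act N) :=
  {| state := bmarking k : finType;
     init := [ffun p => Ordinal (k_bounded_init hk p)];
     delta := fun M a M' => exists t, label t = a /\ fires (tokens M) t (tokens M');
     final := fun M => forall p, tokens M p = final_marking p;
     init_asg := init_data N;
     action_guard := g |}.

End DPN.

(* Main.v *)
Require Import Defs.
From mathcomp Require Import all_boot all_order all_algebra.
From Stdlib Require Import FunctionalExtensionality.

(** By minimality, a constraint graph equals its subgraph of those nodes
    [(b, phi)] whose models are all ends of derivations to [b] (and of the edges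
    between them that come from updates), as this subgraph is closed: this is
    soundness. By closedness, each derivation can be followed in the graph: this
    is completeness. The three equivalences are instances of these two
    facts, the first one using them also for the graphs started in [b], whose
    formulas relate the assignments at the two ends of a derivation. *)

Set Implicit Arguments.
Unset Strict Implicit.
Unset Printing Implicit Defensive.

(** * Evaluation of constraints and formulas *)

Lemma asgP (V : vars) (s s' : asg V) :
  (forall ty (v : V ty), s ty v = s' ty v) -> s = s'.
Proof.
by move=> e; do 2!apply: functional_extensionality_dep => ?; apply: e.
Qed.

Lemma eq_lin_eval (X : eqType) (K : nzRingType) (s s' : X -> K) (e : lin X K) :
  (forall x, lin_occurs x e -> s x = s' x) -> lin_eval s e = lin_eval s' e.
Proof.
elim: e => [x|c|e1 IH1 e2 IH2|c e IH] //= eq_s.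
- exact: eq_s.
- by rewrite IH1 ?IH2 // => x ox; apply: eq_s; rewrite ox ?orbT.
- by rewrite IH.
Qed.

Lemma eq_atom_sat (V : vars) (s s' : asg V) (c : atom V) :
  (forall ty (v : V ty), atom_occurs c v -> s ty v = s' ty v) ->
  atom_sat s c = atom_sat s' c.
Proof.
case: c => [b|b x|o e1 e2|o e1 e2] //= eq_s; first by rewrite eq_s.
- by congr cmp_eval; apply: eq_lin_eval => v ov; apply: (eq_s TInt);
    rewrite ov ?orbT.
- by congr cmp_eval; apply: eq_lin_eval => v ov; apply: (eq_s TRat);
    rewrite ov ?orbT.
Qed.

(** Serves to exchange the assignment of a step for one that differs only at variables foreign to
    the guard. *)
Lemma eq_constraint_sat (V : vars) (s s' : asg V) (c : constraint V) :
  (forall ty (v : V ty), occurs c v -> s ty v = s' ty v) ->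
  constraint_sat s c = constraint_sat s' c.
Proof.
rewrite /constraint_sat; elim: c => //= x c IH eq_s; congr andb.
- by apply: eq_atom_sat => ty v ov; apply: eq_s; rewrite /occurs /= ov.
- by apply: IH => ty v ov; apply: eq_s; rewrite /occurs /= -/(occurs c v) ov orbT.
Qed.

Lemma sat_fconj (V : vars) (s : asg V) (fs : seq (formula V)) :
  sat s (fconj fs) = all (sat s) fs.
Proof. by elim: fs => //= f fs ->. Qed.

Lemma sat_fconj_vars (V W : vars) (s : asg W)
    (f : forall ty, V ty -> formula W) :
  sat s (fconj_vars f) <-> forall ty (v : V ty), sat s (f ty v).
Proof.
rewrite /fconj_vars sat_fconj !all_cat !all_map; split.
- case/and3P => /allP hb /allP hi /allP hr [] v.
  + by apply: hb; rewrite -enumT mem_enum.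
  + by apply: hi; rewrite -enumT mem_enum.
  + by apply: hr; rewrite -enumT mem_enum.
- by move=> h; apply/and3P; split; apply/allP => v _; apply: h.
Qed.

Lemma sat_feq_const (V : vars) (s : asg V) (ty : vtype) (v : V ty) (d : dom ty) :
  sat s (feq_const v d) <-> s ty v = d.
Proof. by case: ty v d => v d; split=> /eqP. Qed.

Lemma sat_feq_var (V : vars) (s : asg V) (ty : vtype) (v w : V ty) :
  sat s (feq_var v w) <-> s ty v = s ty w.
Proof.
case: ty v w => v w; try by split=> /eqP.
by rewrite /=; case: (s TBool v); case: (s TBool w).
Qed.

(** * Initial formulas and transition formulas *)

Section ConstraintGraphCorrectness.
Variables (V : vars) (A : finType) (B : dds V A).

Lemma sat_init_formula (r : asg vnone) (al : asg V) :
  sat (join r al) (init_formula B) <-> al = init_asg B.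
Proof.
split=> [/sat_fconj_vars h | ->]; last first.
- by apply/sat_fconj_vars => ty v; apply/sat_feq_const.
- by apply: asgP => ty v; have /sat_feq_const := h ty v.
Qed.

Lemma sat_copy_formula (r al : asg V) :
  sat (join r al) (copy_formula V) <-> al = r.
Proof.
split=> [/sat_fconj_vars h | ->]; last first.
- by apply/sat_fconj_vars => ty v; apply/sat_feq_var.
- by apply: asgP => ty v; have /sat_feq_var := h ty v.
Qed.

(* A step may choose arbitrary values [v^w] for variables [v] that are not
   written, whereas the formula forces [v^w = v^r]; the guard does not see the
   difference, as these [v^w] do not occur in it. *)
Lemma sat_trans_formula (a : A) (u al : asg V) :
  sat (join u al) (trans_formula B a) <->
  exists be, data_step (action_guard B a) u be al.
Proof.
rewrite /trans_formula /= sat_fconj all_map; split.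
- case/andP => hg /sat_fconj_vars hw; exists (join u al); split=> // ty v.
  by have := hw ty v; case: ifP => // _ /sat_feq_var.
- case=> be [hr hg hw]; apply/andP; split.
  + rewrite -[X in is_true X]/(constraint_sat (join u al) (action_guard B a)).
    rewrite -(eq_constraint_sat (s := be)) // => ty [v|v] ov /=; first exact: hr.
    by rewrite hw /written ov.
  + apply/sat_fconj_vars => ty v; case: ifP => // nw.
    by apply/sat_feq_var; rewrite /= hw nw.
Qed.

(** * Soundness and completeness of constraint graphs *)

Section Graph.
Variables (X : vars) (s0 : cgnode B X) (G : cgraph B X).
Hypothesis hG : is_constraint_graph s0 G.

(** The initial node is exempt from satisfiability, as [s0.2] is arbitrary here; every other node
    has to come from a satisfiable update. The assignment [r] of [X] is the same at both ends of the
    derivation. *)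
Definition sound_node (s : cgnode B X) : Prop :=
  (s = s0 \/ exists r al, sat (join r al) s.2) /\
  forall r al, sat (join r al) s.2 ->
    exists u, sat (join r u) s0.2 /\ derivation (s0.1, u) (s.1, al).

(** Closedness alone admits stray edges between any two nodes; minimality will exclude them. *)
Definition sound_edge (s : cgnode B X) (a : A) (s' : cgnode B X) : Prop :=
  [/\ delta s.1 a s'.1, update_satisfiable B s.2 a & equiv_update B s'.2 s.2 a].

Lemma constraint_graph_sound :
  (forall s, node G s -> sound_node s) /\
  (forall s a s', edge G s a s' ->
     [/\ node G s, node G s' & sound_edge s a s']).
Proof.
have [[G0 Ge Gs] Gmin] := hG.
pose G' := CGraph (fun s => node G s /\ sound_node s)
  (fun s a s' => [/\ edge G s a s', sound_node s, sound_node s'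
                   & sound_edge s a s']).
have sub : subgraph G' G by split=> [s []|s a s' []].
have clo : cg_closed s0 G'.
  split=> /=.
  - split=> //; split; first by left.
    by move=> r al sal; exists al; split=> //; apply: derivation_nil.
  - by move=> s a s' [/Ge [? ?] ? ? _].
  - move=> b phi a b' [nG [ne snd]] dl us.
    have [phi' [eq nG' eG]] := Gs _ _ _ _ nG dl us.
    (* A model of the update comes from a model [u] of [phi] by one step, which extends the
       derivation ending in [u]. *)
    have snd' : sound_node (b', phi').
      split; first by right; have [r [al /eq]] := us; exists r, al.
      move=> r al /= /eq [u [su /sat_trans_formula [be st]]].
      have [u0 [su0 der]] := snd _ _ su.
      exists u0; split=> //.
      by apply: (derivation_step der (a := a) (be := be)); split.
    by exists phi'; split.
have [minn mine] := Gmin _ sub clo.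
split=> [s /minn [] //|s a s' eG].
by have [? ?] := Ge _ _ _ eG; have [_ _ _ ?] := mine _ _ _ eG.
Qed.

(** Induction on the derivation with [r] fixed: the assignments before and after a step witness that
    the update is satisfiable, so closedness yields the next node. *)
Lemma constraint_graph_complete (r : asg X) (u : asg V) (y : config B) :
  sat (join r u) s0.2 -> derivation (s0.1, u) y ->
  exists2 phi, node G (y.1, phi) & sat (join r y.2) phi.
Proof.
have [[G0 _ Gs] _] := hG.
move=> su; elim=> [|{}y a be z _ [phi nG sy] [dl st]].
  by exists s0.2 => //; case: (s0) G0.
have upd : update B phi a r z.2.
  by exists y.2; split=> //; apply/sat_trans_formula; exists be.
have us : update_satisfiable B phi a by exists r, z.2.
by have [phi' [eq nG' _]] := Gs _ _ _ _ nG dl us; exists phi' => //; apply/eq.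
Qed.

End Graph.

(** * Graph properties and runs *)

Section CG.
Variable G : cgraph B vnone.
Hypothesis hG : is_CG G.

Lemma CG_node_run (b : state B) (phi : formula (vsum vnone V)) r al :
  node G (b, phi) -> sat (join r al) phi -> run_to (b, al).
Proof.
have [snd _] := constraint_graph_sound hG.
by move=> /snd [_ /[apply]] /= [u [/sat_init_formula ->]].
Qed.

(** The exempt initial node is satisfiable too, by the initial assignment. *)
Lemma CG_node_satisfiable (b : state B) phi :
  node G (b, phi) -> exists r al, sat (join r al) phi.
Proof.
have [snd _] := constraint_graph_sound hG.
case/snd => [[[_ ->]|//] _].
by exists noasg, (init_asg B); apply/sat_init_formula.
Qed.

Lemma run_CG_node (x : config B) :
  run_to x -> exists2 phi, node G (x.1, phi) & sat (join noasg x.2) phi.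
Proof. by apply: (constraint_graph_complete hG); apply/sat_init_formula. Qed.

Lemma CG_nodeP (b : state B) :
  (exists phi, node G (b, phi)) <-> reachable_state b.
Proof.
split=> [[phi nG]|[al /run_CG_node [phi nG _]]]; last by exists phi.
have [r [al sal]] := CG_node_satisfiable nG.
by exists al; apply: CG_node_run nG sal.
Qed.

Lemma CG_edgeP (a : A) :
  (exists s s', edge G s a s') <->
  (exists b b', reachable_transition (B := B) b a b').
Proof.
split.
- case=> [[b phi] [[b' phi'] eG]].
  have [_ snd] := constraint_graph_sound hG.
  have [nG _ [dl us _]] := snd _ _ _ eG.
  (* Here [u] is the assignment before the step; as a model of [phi] it is reached by a run. *)
  have [r [al [u [su /sat_trans_formula [be st]]]]] := us.
  exists b, b', u, be, al; split=> //.
  exact: CG_node_run nG su.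
- case=> [b [b' [al [be [al' [run [dl st]]]]]]].
  have [phi nG sal] := run_CG_node run.
  have us : update_satisfiable B phi a.
    exists noasg, al', al; split=> //; apply/sat_trans_formula.
    by exists be.
  have [[_ _ Gs] _] := hG.
  have [phi' [_ _ eG]] := Gs _ _ _ _ nG dl us.
  by exists (b, phi), (b', phi').
Qed.

(** The copy of the variables remembers the starting assignment: [copy_formula] forces the
    derivation given by soundness to start in [al]. *)
Lemma final_formulaP (b : state B) (Gb : cgraph B V) (al : asg V) :
  is_CG_from b Gb ->
  (exists psi, final_formula Gb psi /\ exists al', sat (join al al') psi) <->
  (exists y, derivation (b, al) y /\ final y.1).
Proof.
move=> hb; split.
- case=> psi [[bF [fin nG]] [al' sal']].
  have [snd _] := constraint_graph_sound hb.
  have [_ /(_ _ _ sal') [u [/sat_copy_formula -> der]]] := snd _ nG.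
  by exists (bF, al').
- case=> y [der fin].
  have sal : sat (join al al) (copy_formula V) by apply/sat_copy_formula.
  have [psi nG sy] := constraint_graph_complete hb sal der.
  by exists psi; split; [exists y.1 | exists y.2].
Qed.

Lemma CG_blockedP (H : state B -> cgraph B V) :
  (forall b, is_CG_from b (H b)) ->
  (exists b phi, [/\ node G (b, phi), ~ final b
                   & blocked_satisfiable (H b) phi])
  <-> has_blocked_state B.
Proof.
move=> hH; split.
- case=> b [phi [nG _ [al [sal blk]]]].
  exists (b, al); split; first exact: CG_node_run nG sal.
  by move/(final_formulaP _ (hH b)) => [psi [/blk]].
- case=> [[b al] [run blk]].
  have [phi nG sal] := run_CG_node run.
  exists b, phi; split=> //.
    (* A final state is never blocked, because of the empty derivation. *)
    by move=> fin; apply: blk; exists (b, al); split=> //; apply: derivation_nil.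
  exists al; split=> // psi fin ex.
  by apply/blk/(final_formulaP _ (hH b)); exists psi.
Qed.

End CG.
End ConstraintGraphCorrectness.

Theorem theorem1 (N : dpn) (k : nat) (hk : k_bounded N k)
    (g : act N -> constraint (rw (dvars N)))
    (hg : forall t : trans N, g (label t) = guard t) :
  let B := dds_of hk g in
  forall (G : cgraph B vnone) (hG : is_CG G)
         (H : state B -> cgraph B (dvars N)) (hH : forall b, is_CG_from b (H b)),
  [/\ (exists b phi, [/\ node G (b, phi), ~ final b
                       & blocked_satisfiable (H b) phi])
      <-> has_blocked_state B,
      (exists t : trans N, forall s s', ~ edge G s (label t) s')
      <-> (exists t : trans N, forall b b' : state B,
             delta b (label t) b' -> ~ reachable_transition b (label t) b')
    & (exists (b : bmarking N k) phi,
          node G (b, phi) /\ forall p, final_marking p <= tokens b p)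
      <-> (exists b : bmarking N k,
             (forall p, final_marking p <= tokens b p) /\
             reachable_state (B := B) b)].
Proof.
move=> B G hG H hH; split; first exact: CG_blockedP.
- split=> -[t ht]; exists t.
  + move=> b b' _ rt.
    have [|s [s' e]] := (CG_edgeP hG (label t)).2; first by exists b, b'.
    exact: ht e.
  + move=> s s' e.
    have [|b [b' rt]] := (CG_edgeP hG (label t)).1; first by exists s, s'.
    (* The step in a reachable transition supplies the [delta] premise of [ht]. *)
    have [al [be [al' [_ [dl _]]]]] := rt.
    exact: ht dl rt.
- split=> [[b [phi [nG le]]]|[b [le /(CG_nodeP hG) [phi nG]]]].
  + by exists b; split=> //; apply/(CG_nodeP hG); exists phi.
  + by exists b, phi.
Qed.
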